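(* In the setting described in the context, let $M^\star$ be an integer with $K\le M^\star\le N$. For every $z_i\in D$, the approximation $\widehat\phi^{(M^\star)}_{z_i}$ (1) shares the same sign as the exact Shapley value $\phi_{z_i}$, (2) satisfies $|\widehat\phi^{(M^\star)}_{z_i}|\le|\phi_{z_i}|$, and (3) satisfies $|\widehat\phi^{(M^\star)}_{z_i}-\phi_{z_i}|\le\varepsilon(M^\star)$, where $$\varepsilon(M^\star):=\sum_{m=M^\star+1}^{N}\Big(\frac1{m-K}-\frac1m\Big)+\sum_{\ell=1}^{K-1}\frac{\binom N\ell-\binom{M^\star}\ell}{N\binom{N-1}\ell}=O(K/M^\star).$$
   Context: Training set $D=\{z_1,\dots,z_N\}$, $z_i=(x_i,y_i)$ with binary labels, validation point $z^{(\mathrm{val})}=(x^{(\mathrm{val})},y^{(\mathrm{val})})$, points indexed so that $d(x_1,x^{(\mathrm{val})})\le\cdots\le d(x_N,x^{(\mathrm{val})})$; integer $K\ge2$, $N\ge K$. Weights $w_j\in[0,1]$; signed weights $\widetilde w_j=w_j$ if $y_j=y^{(\mathrm{val})}$, $-w_j$ otherwise. For $S\subseteq D$, $\alpha(S,j)$ is the $j$-th smallest index in $S$; $v(S)=\mathbb 1[\sum_{j=1}^{\min(K,|S|)}\widetilde w_{\alpha(S,j)}\ge0]$; Shapley value $\phi_z=\frac1N\sum_{k=1}^N\binom{N-1}{k-1}^{-1}\sum_{S\subseteq D\setminus\{z\},|S|=k-1}[v(S\cup\{z\})-v(S)]$. $\mathrm{Cond}_{KNN}$ for $S\subseteq D\setminus\{z_i\}$: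 $|\{z_j\in S:j<i\}|\le K-1$. $F_i[m,\ell,s]$ ($m\in[N]$, $1\le\ell\le N-1$, $s\in\mathbb R$): number of $S\subseteq D\setminus\{z_i\}$ with $|S|=\ell$, $\mathrm{Cond}_{KNN}$, $\alpha(S,\min(\ell,K))=m$, $\sum_{j=1}^{\min(\ell,K-1)}\widetilde w_{\alpha(S,j)}=s$. $R_{i,m}=\sum_{t=1}^{m-1}\sum_{s\in[-\widetilde w_i,-\widetilde w_m)}F_i[t,K-1,s]$ if $y_i=y^{(\mathrm{val})}$, and $\sum_{t=1}^{m-1}\sum_{s\in[-\widetilde w_m,-\widetilde w_i)}F_i[t,K-1,s]$ otherwise. $\widetilde G^{(M^\star)}_{i,0}=\mathbb 1[\widetilde w_i<0]$; for $1\le\ell\le K-1$, $\widetilde G^{(M^\star)}_{i,\ell}=\sum_{m=1}^{M^\star}\sum_{s\in[-\widetilde w_i,0)}F_i[m,\ell,s]$ if $y_i=y^{(\mathrm{val})}$, and $\sum_{m=1}^{M^\star}\sum_{s\in[0,-\widetilde w_i)}F_i[m,\ell,s]$ otherwise. $\widehat\phi^{(M^\star)}_{z_i}=(2\mathbb 1[y_i=y^{(\mathrm{val})}]-1)\big[\frac1N\sum_{\ell=0}^{K-1}\widetilde G^{(M^\star)}_{i,\ell}/\binom{N-1}\ell+\sum_{m=\max(i+1,K+1)}^{M^\star}R_{i,m}/(m\binom{m-1}K)\big]$. Sums over $s\in[a,b)$ range over the finitely many real $s$ in $[a,b)$ with nonzero summand. The $O(\cdot)$ is asymptotic as $M^\star\to\infty$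 (with $N\ge M^\star$).
   Formalization: The claim is false for arbitrary weights in [0,1]; it is proved assuming the weights do not increase with distance rank (w_j ≤ w_i for i ≤ j), and ''same sign'' means that the approximation, when nonzero, has the sign of the exact Shapley value. *)

(* Defs.v *)
From HB Require Import structures.
From mathcomp Require Import all_boot all_order all_algebra.
From mathcomp Require Import classical_sets set_interval fsbigop reals.

Set Implicit Arguments.
Unset Strict Implicit.
Unset Printing Implicit Defensive.

Import Order.TTheory GRing.Theory Num.Theory.

Local Open Scope ring_scope.

(* The training point z_a (1 <= a <= N) is the ordinal i : 'I_N with
   i.+1 = a, and a subset of D is the set of the indices of its points.
   Cardinalities, positions j in alpha S j, K, M and l are the usual ones
   (not shifted). *)

Definition signed_weight (R : realType) (N : nat) (y : 'I_N -> bool)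
    (yval : bool) (w : 'I_N -> R) (j : 'I_N) : R :=
  if y j == yval then w j else - w j.

(* [enum] lists a set of ordinals in increasing order; positions start at 1,
   and the result is [Some _] for 1 <= j <= #|S|. *)
Definition alpha (N : nat) (S : {set 'I_N}) (j : nat) : option 'I_N :=
  onth (enum S) j.-1.

(* sum_(j = 1)^n wt_(alpha(S, j)); only used with n <= #|S|. *)
Definition prefix_weight (R : realType) (N : nat) (wt : 'I_N -> R)
    (S : {set 'I_N}) (n : nat) : R :=
  \sum_(1 <= j < n.+1) oapp wt 0 (alpha S j).

Definition utility (R : realType) (N K : nat) (wt : 'I_N -> R)
    (S : {set 'I_N}) : R :=
  (0 <= prefix_weight wt S (minn K #|S|))%R%:R.

Definition shapley (R : realType) (N : nat) (v : {set 'I_N} -> R)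
    (i : 'I_N) : R :=
  N%:R^-1 * \sum_(1 <= k < N.+1) 'C(N.-1, k.-1)%:R^-1 *
    \sum_(S : {set 'I_N} | (i \notin S) && (#|S| == k.-1))
      (v (i |: S) - v S).

Definition cond_knn (N K : nat) (i : 'I_N) (S : {set 'I_N}) : bool :=
  (#|[set j in S | (j < i)%N]| <= K.-1)%N.

Definition Fcount (R : realType) (N K : nat) (wt : 'I_N -> R)
    (i m : 'I_N) (l : nat) (s : R) : nat :=
  #|[set S : {set 'I_N} |
      [&& i \notin S, #|S| == l, cond_knn K i S,
          alpha S (minn l K) == Some m
        & prefix_weight wt S (minn l K.-1) == s]]|.

(* In the sums over s below, [\sum_(s \in A)] is the sum over the (finitely
   many) s in A with a nonzero summand. *)

Definition Rterm (R : realType) (N K : nat) (y : 'I_N -> bool) (yval : bool)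
    (w : 'I_N -> R) (i m : 'I_N) : R :=
  let wt := signed_weight y yval w in
  if y i == yval then
    \sum_(t < N | (t < m)%N)
      \sum_(s \in [set s : R | - wt i <= s < - wt m]%classic)
        ((Fcount K wt i t K.-1 s)%:R : R)
  else
    \sum_(t < N | (t < m)%N)
      \sum_(s \in [set s : R | - wt m <= s < - wt i]%classic)
        ((Fcount K wt i t K.-1 s)%:R : R).

Definition Gtilde (R : realType) (N K : nat) (y : 'I_N -> bool) (yval : bool)
    (w : 'I_N -> R) (M : nat) (i : 'I_N) (l : nat) : R :=
  let wt := signed_weight y yval w in
  if l == 0%N then (wt i < 0)%R%:R
  else if y i == yval then
    \sum_(m < N | (m.+1 <= M)%N)
      \sum_(s \in [set s : R | - wt i <= s < 0]%classic)
        ((Fcount K wt i m l s)%:R : R)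
  else
    \sum_(m < N | (m.+1 <= M)%N)
      \sum_(s \in [set s : R | 0 <= s < - wt i]%classic)
        ((Fcount K wt i m l s)%:R : R).

(* With a = i.+1 and b = m.+1, the second sum ranges over
   max(a + 1, K + 1) <= b <= M and divides by b * 'C(b - 1, K). *)
Definition phihat (R : realType) (N K : nat) (y : 'I_N -> bool) (yval : bool)
    (w : 'I_N -> R) (M : nat) (i : 'I_N) : R :=
  (2 * (y i == yval)%:R - 1) *
  (N%:R^-1 * (\sum_(0 <= l < K)
                Gtilde K y yval w M i l / 'C(N.-1, l)%:R)
   + \sum_(m < N | (maxn i.+2 K.+1 <= m.+1 <= M)%N)
       Rterm K y yval w i m / (m.+1%:R * 'C(m, K)%:R)).

Definition epsilon (R : realType) (N K M : nat) : R :=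
  \sum_(M.+1 <= m < N.+1) ((m%:R - K%:R)^-1 - m%:R^-1)
  + \sum_(1 <= l < K)
      ('C(N, l)%:R - 'C(M, l)%:R) / (N%:R * 'C(N.-1, l)%:R).

(* Main.v *)
Require Import Defs.
From HB Require Import structures.
From mathcomp Require Import all_boot all_order all_algebra.
From mathcomp Require Import classical_sets set_interval fsbigop reals.
From mathcomp Require Import zify ring lra.

Set Implicit Arguments.
Unset Strict Implicit.
Unset Printing Implicit Defensive.

Import Order.TTheory GRing.Theory Num.Theory.

Local Open Scope ring_scope.

(* The marginal contribution of z_i to S is nonzero only if z_i enters the K
   nearest neighbours, replacing no point (|S| < K) or the K-th point m of S
   (|S| >= K), and if this flips the vote. Weights decrease with the rank, so
   the flip is always in the direction of the label of z_i, and all the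
   contributions have the same sign. For |S| >= K, group the sets S by m and by
   the set T of their K - 1 points before m: there are C(N - m, l - K) such sets
   of size l, and
     sum_l C(N - m, l - K) / C(N - 1, l) = N / (m C(m - 1, K)).
   Hence the exact value is the approximation with M = N, and both are partial
   sums of the same series of terms of constant sign. The discarded terms are
   bounded by counting all sets, whatever their weight. *)

(** * Initial segments of a set of ranks, and their weights *)

(** Ordinals are shifted by one, so [below S m] holds the points of [S] of rank at most [m]. The
    equation [below S M == S] is used throughout to say that [S] lies among the [M] nearest
    points. *)
Definition below (N : nat) (S : {set 'I_N}) (m : nat) : {set 'I_N} :=
  [set j in S | (j < m)%N].

Lemma sorted_enum_set (N : nat) (S : {set 'I_N}) :
  sorted (relpre val ltn) (enum S).
Proof.
rewrite /enum_mem; apply: sorted_filter; first by move=> ? ? ? /=; apply: ltn_trans.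
by rewrite -sorted_map -enumT val_enum_ord iota_ltn_sorted.
Qed.

(** Both sides are strictly increasing lists with the same members. Prefixes of the enumeration thus
    become sets [below S m], and prefix weights become plain sums over sets. *)
Lemma enum_below (N : nat) (S : {set 'I_N}) (m : nat) :
  enum S = enum (below S m) ++ enum (S :\: below S m).
Proof.
have lt_trans : transitive (relpre (@nat_of_ord N) ltn).
  by move=> ? ? ? /=; apply: ltn_trans.
apply: (irr_sorted_eq lt_trans) => [x /=|||x]; first by rewrite ltnn.
- exact: sorted_enum_set.
- rewrite sorted_pairwise // pairwise_cat -!sorted_pairwise // !sorted_enum_set.
  rewrite !andbT; apply/allrelP => x z; rewrite !mem_enum !inE.
  move=> /andP[_ lt_xm] /andP[+ Sz]; rewrite Sz /= -leqNgt.
  exact: leq_trans.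
- by rewrite mem_cat !mem_enum !inE; case: (x \in S); case: (_ < _)%N.
Qed.

Lemma prefix_weight_take (R : realType) (N : nat) (wt : 'I_N -> R)
    (S : {set 'I_N}) (n : nat) :
  prefix_weight wt S n = \sum_(j <- take n (enum S)) wt j.
Proof.
rewrite /prefix_weight big_add1 /= /alpha /=.
elim: (enum S) n => [|x s IHs] n.
  by rewrite big_nil big1 // => j _; rewrite onth0n.
case: n => [|n]; first by rewrite take0 big_nil big_geq.
by rewrite big_nat_recl //= big_cons IHs.
Qed.

Lemma prefix_weight_below (R : realType) (N : nat) (wt : 'I_N -> R)
    (S : {set 'I_N}) (m n : nat) :
  #|below S m| = n -> prefix_weight wt S n = \sum_(j in below S m) wt j.
Proof.
move=> Sm; rewrite prefix_weight_take (enum_below S m) take_size_cat.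
  by rewrite big_enum.
by rewrite -cardE.
Qed.

Lemma below_ord (N : nat) (S : {set 'I_N}) : below S N = S.
Proof. by apply/setP => j; rewrite !inE ltn_ord andbT. Qed.

Lemma prefix_weight_card (R : realType) (N : nat) (wt : 'I_N -> R)
    (S : {set 'I_N}) :
  prefix_weight wt S #|S| = \sum_(j in S) wt j.
Proof. by rewrite (@prefix_weight_below _ _ _ _ N) below_ord. Qed.

Lemma alpha_card_below (N : nat) (S : {set 'I_N}) (m : 'I_N) :
  m \in S -> alpha S #|below S m|.+1 = Some m.
Proof.
move=> Sm; rewrite /alpha /= (enum_below S m) onth_cat -cardE ltnn subnn.
have := sorted_enum_set (S :\: below S m).
have : m \in enum (S :\: below S m) by rewrite mem_enum !inE Sm ltnn.
have : {in enum (S :\: below S m), forall x : 'I_N, (m <= x)%N}.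
  by move=> x; rewrite mem_enum !inE => /andP[+ Sx]; rewrite Sx -leqNgt.
case: (enum _) => [|x s] //= le_m; rewrite inE => /predU1P[-> //|s_m].
move=> /(order_path_min _)-/(_ _)/allP-/(_ _ m s_m) /=.
move=> /(_ (fun _ _ _ => @ltn_trans _ _ _)).
by rewrite ltnNge le_m // mem_head.
Qed.

Lemma alpha_Some (N : nat) (S : {set 'I_N}) (n : nat) (m : 'I_N) :
  alpha S n.+1 = Some m <-> m \in S /\ #|below S m| = n.
Proof.
split=> [Snm|[Sm <-]]; last exact: alpha_card_below.
have Sm : m \in S by rewrite -mem_enum; apply/onthP; exists n.
split=> //; apply: (@onth_inj _ (enum S)); rewrite ?enum_uniq //.
  rewrite gtn_min -cardE [X in _ || X](_ : _ = true) ?orbT //.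
  apply/proper_card/properP; split; last by exists m; rewrite // !inE ltnn andbF.
  by apply/fintype.subsetP => j; rewrite inE => /andP[].
by have := alpha_card_below Sm; rewrite /alpha /= => ->.
Qed.

Lemma alpha_in_range (N : nat) (S : {set 'I_N}) (n : nat) :
  (n < #|S|)%N -> exists m, alpha S n.+1 = Some m.
Proof.
rewrite /alpha /= cardE -onthTE; case: onth => // m _; by exists m.
Qed.

Lemma below_id (N : nat) (S : {set 'I_N}) (m : nat) :
  (below S m == S) = [forall j in S, (j < m)%N].
Proof.
apply/eqP/forall_inP => [<- j|lt_m]; first by rewrite inE => /andP[].
by apply/setP => j; rewrite inE; apply: andb_idr; apply: lt_m.
Qed.

(** [alpha S #|S|] is the largest element of [S]. Nonemptiness matters: for the empty set the left
    side is true, while [alpha] returns [None]. *)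
Lemma alpha_card_lt (N : nat) (S : {set 'I_N}) (m : nat) :
  (0 < #|S|)%N ->
  (below S m == S) = oapp (fun t : 'I_N => (t < m)%N) false (alpha S #|S|).
Proof.
case cardS: #|S| => [//|n] _.
have [t alpha_t] : exists t, alpha S n.+1 = Some t.
  by apply: alpha_in_range; rewrite cardS.
have [St card_t] := (alpha_Some _ _ _).1 alpha_t.
rewrite alpha_t below_id /=; apply/forall_inP/idP => [|lt_tm j Sj]; first exact.
have : S = t |: below S t.
  apply/eqP; rewrite eq_sym eqEcard cardsU1 card_t !inE ltnn andbF cardS leqnn.
  by rewrite andbT; apply/fintype.subsetP => k; rewrite !inE => /predU1P[->|/andP[]].
move/setP/(_ j); rewrite Sj !inE => /esym/predU1P[-> //|/andP[_]].
by move/ltn_trans; apply.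
Qed.

(** * From counts indexed by a weight to sums over subsets *)

(** Each [S] with [Q S] is counted once, at [s = W S]. The list [r] of the attained values in [P]
    contains every [s] with a nonempty fibre, which makes the sum over reals finite. *)
Lemma fsum_card_fibre (R : realType) (T : finType) (Q : pred T) (W : T -> R)
    (P : pred R) :
  \sum_(s \in [set s : R | P s]%classic)
     (#|[set S | Q S && (W S == s)]|%:R : R) =
  \sum_(S | Q S) (P (W S))%:R.
Proof.
pose r := undup [seq W A | A <- enum T & P (W A)].
have rP s : s \in r -> P s.
  by rewrite mem_undup => /mapP[S]; rewrite mem_filter => /andP[PS _] ->.
rewrite (@fsbigE _ _ _ _ _ r) ?undup_uniq //=; first last.
- move=> s Ps; apply: contraNeq; rewrite pnatr_eq0 cards_eq0.
  case/set0Pn=> S; rewrite inE => /andP[_ /eqP WS].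
  by rewrite mem_undup; apply/mapP; exists S; rewrite // mem_filter mem_enum WS Ps.
rewrite big_seq_cond (eq_bigl (mem r)); last first.
  move=> s; rewrite /= andb_idr // => /rP Ps; exact: mem_set.
transitivity (\sum_(s <- r) \sum_(S | Q S) ((W S == s)%:R : R)).
  rewrite -big_seq; apply: eq_bigr => s _.
  under [RHS]eq_bigr do rewrite mulrb.
  rewrite -sum1_card natr_sum -big_mkcondr /=.
  by apply: eq_bigl => S; rewrite inE.
rewrite exchange_big /=; apply: eq_bigr => S _; have [PS|nPS] := boolP (P (W S)).
  rewrite (bigD1_seq (W S)) ?undup_uniq ?eqxx //= ?big1 ?addr0 //.
    by move=> s; rewrite eq_sym => /negbTE->.
  by rewrite mem_undup; apply/mapP; exists S; rewrite // mem_filter PS mem_enum.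
rewrite big_seq big1 // => s /rP Ps; case: eqP => // WS.
by rewrite WS Ps in nPS.
Qed.

(** For [l < K] both minima in [Fcount] equal [l], the neighbour condition holds because [S] has at
    most [K - 1] points, and [m] is the last point of [S]. Summing over [m] only bounds this last
    point. *)
Lemma sum_Fcount (R : realType) (N K : nat) (wt : 'I_N -> R) (i : 'I_N)
    (M l : nat) (P : pred R) :
  (0 < l)%N -> (l < K)%N ->
  \sum_(m < N | (m < M)%N)
     \sum_(s \in [set s : R | P s]%classic) ((Fcount K wt i m l s)%:R : R) =
  \sum_(S : {set 'I_N} | [&& i \notin S, #|S| == l & below S M == S])
     (P (\sum_(j in S) wt j))%:R.
Proof.
move=> l_gt0 lt_lK; have minlK : minn l K = l by apply/minn_idPl/ltnW.
have minlK1 : minn l K.-1 = l by apply/minn_idPl; lia.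
(* The default [i] is never taken: [alpha S l] is defined since [#|S| = l > 0]. *)
rewrite [RHS](partition_big (fun S => odflt i (alpha S l))
   (fun m : 'I_N => m < M)%N) /=; last first.
  move=> S /and3P[_ /eqP cardS]; rewrite alpha_card_lt cardS //.
  by case: (alpha S l).
apply: eq_bigr => m lt_mM.
pose Q (S : {set 'I_N}) := [&& i \notin S, #|S| == l & alpha S l == Some m].
transitivity (\sum_(S | Q S) ((P (\sum_(j in S) wt j))%:R : R)).
  rewrite -fsum_card_fibre; apply: eq_fsbigr => s _; congr _%:R.
  apply: eq_card => S; rewrite !inE /Q minlK minlK1 -!andbA.
  case: (i \notin S) => //=; case: eqP => //= cardS.
  rewrite -{2}cardS prefix_weight_card.
  suff -> : cond_knn K i S by [].
  rewrite /cond_knn -/(below S i) (leq_trans (_ : _ <= #|S|)%N) //; last first.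
    by rewrite cardS; lia.
  by apply/subset_leq_card/fintype.subsetP => j; rewrite inE => /andP[].
apply: eq_bigl => S; rewrite /Q -!andbA; case: (i \notin S) => //=.
case: eqP => //= cardS; rewrite alpha_card_lt cardS //.
have [n def_l] : exists n, l = n.+1 by exists l.-1; lia.
have [t ->] : exists t, alpha S l = Some t.
  by rewrite def_l; apply: alpha_in_range; rewrite cardS def_l.
rewrite /= (inj_eq Some_inj); case: eqP => [->|]; rewrite ?andbF ?andbT //.
Qed.

(** * Counting extensions, and a sum of ratios of binomials *)

Lemma card_ord_lt (N m : nat) : (m <= N)%N -> #|[set j : 'I_N | (j < m)%N]| = m.
Proof.
move=> le_mN; rewrite -sum1_card (eq_bigl (fun j : 'I_N => j < m)%N); last first.
  by move=> j; rewrite inE.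
by rewrite -(big_ord_widen _ (fun=> 1%N) le_mN) sum1_card card_ord.
Qed.

Lemma card_ord_gt (N : nat) (m : 'I_N) :
  #|[set j : 'I_N | (m < j)%N]| = (N.-1 - m)%N.
Proof.
have := cardsC [set j : 'I_N | (j < m.+1)%N].
rewrite card_ord_lt // card_ord => cardN.
suff <- : ~: [set j : 'I_N | (j < m.+1)%N] = [set j : 'I_N | (m < j)%N] by lia.
by apply/setP => j; rewrite !inE ltnS -ltnNge.
Qed.

(** Such an [S] consists of [T], of [m], and of arbitrary [l - #|T| - 1] points above [m]. The map
    [f] rebuilds [S] from the latter, and intersecting with [above] inverts it. *)
Lemma card_extensions (N : nat) (m : 'I_N) (T : {set 'I_N}) (l : nat) :
  below T m = T -> (#|T| < l)%N ->
  #|[set S : {set 'I_N} | [&& #|S| == l, m \in S & below S m == T]]| =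
  'C(N.-1 - m, l - #|T|.+1).
Proof.
move=> Tm lt_Tl; rewrite -card_ord_gt -cards_draws.
set above := [set j : 'I_N | (m < j)%N].
have T_lt j : j \in T -> (j < m)%N by rewrite -Tm inE => /andP[].
pose f (U : {set 'I_N}) : {set 'I_N} := m |: (T :|: U).
have fK (U : {set 'I_N}) : U \subset above -> f U :&: above = U.
  move=> sU; apply/setP => j; rewrite !inE.
  have := fintype.subsetP sU j; rewrite inE.
  have [Uj /(_ isT) ->|_ _] := boolP (j \in U); first by rewrite !orbT.
  rewrite orbF; case: eqP => [->|_] /=; first by rewrite ltnn.
  by apply/negbTE/negP => /andP[/T_lt]; lia.
rewrite -[RHS](card_in_imset (f := f)); last first.
  move=> U V; rewrite !inE => /andP[sU _] /andP[sV _] eqf.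
  by rewrite -(fK U sU) eqf fK.
apply: eq_card => S; rewrite !inE; apply/idP/imsetP.
  case/and3P=> /eqP cardS Sm /eqP SmT.
  have defS : S = f (S :&: above).
    apply/setP => j; rewrite !inE -SmT inE.
    case: (eqVneq j m) => [->|ne_jm]; first by rewrite Sm.
    rewrite -andb_orr orFb -neq_ltn; apply: esym; apply: andb_idr => _.
    by rewrite -val_eqE in ne_jm.
  exists (S :&: above) => //; rewrite inE subsetIr /=.
  have SD : S :\: above = m |: T.
    apply/setP => j; rewrite !inE -SmT inE -leqNgt leq_eqVlt.
    case: (eqVneq j m) => [->|ne_jm]; rewrite ?Sm ?eqxx //.
    by rewrite andbC val_eqE (negbTE ne_jm).
  have : m \notin T by apply/negP => /T_lt; rewrite ltnn.
  have := cardsID above S; rewrite cardS SD cardsU1 => + mT; rewrite mT => cardD.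
  by rewrite -cardD add1n addnK.
case=> U; rewrite inE => /andP[sU /eqP cardU] ->.
have U_gt j : j \in U -> (m < j)%N.
  by move/(fintype.subsetP sU); rewrite inE.
have mTU : m \notin T :|: U.
  rewrite inE negb_or; apply/andP; split; apply/negP.
    by move/T_lt; rewrite ltnn.
  by move/U_gt; rewrite ltnn.
rewrite setU11 /= cardsU1 mTU cardsU.
have -> : T :&: U = finset.set0.
  apply/setP => j; rewrite !inE; apply/negbTE/negP => /andP[/T_lt + /U_gt]; lia.
rewrite cards0 subn0 cardU; apply/andP; split; first by apply/eqP; lia.
apply/eqP/setP => j; rewrite !inE.
case: (eqVneq j m) => [->|_] /=.
  by rewrite ltnn; apply/esym/negbTE; move: mTU; rewrite inE negb_or => /andP[].
have [/T_lt -> //|_ /=] := boolP (j \in T).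
by apply/negbTE/negP => /andP[/U_gt]; lia.
Qed.

(** Induction on [p]: Pascal's rule splits the sum into the sums for [p] with [k] and with
    [k + 1]. *)
Lemma sum_binomial_ratio (R : realType) (n p k : nat) :
  (p + k <= n)%N ->
  \sum_(0 <= j < p.+1) ('C(p, j)%:R / 'C(n, j + k)%:R : R) =
  n.+1%:R / ((n - p).+1%:R * 'C(n - p, k)%:R).
Proof.
elim: p k => [|p IHp] k le_n.
  by rewrite big_nat1 bin0 subn0 add0n invfM mulrA divff ?pnatr_eq0.
rewrite big_nat_recl // add0n bin0.
under eq_bigr do rewrite binS natrD mulrDl.
rewrite big_split /= addrA.
have -> : \sum_(0 <= j < p.+1) ('C(p, j)%:R / 'C(n, j.+1 + k)%:R : R) =
          \sum_(0 <= j < p.+1) 'C(p, j)%:R / 'C(n, j + k.+1)%:R.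
  by apply: eq_bigr => j _; rewrite addSnnS.
(* The term at [j = p] has numerator ['C(p, p.+1) = 0]. The others, with the isolated
   [1 / 'C(n, k)], form the sum for [p] and [k]. *)
rewrite [X in _ + X + _]big_nat_recr //= (@bin_small p p.+1) // mul0r addr0.
have -> : (1%:R / 'C(n, k)%:R : R) + \sum_(0 <= j < p) 'C(p, j.+1)%:R / 'C(n, j.+1 + k)%:R
     = \sum_(0 <= j < p.+1) 'C(p, j)%:R / 'C(n, j + k)%:R.
  by rewrite [RHS]big_nat_recl // bin0 add0n.
rewrite !IHp; [|lia|lia].
have -> : (n - p = (n - p.+1).+1)%N by lia.
set q := (n - p.+1)%N; have le_kq : (k <= q)%N by rewrite /q; lia.
(* These give [(q+1) C(q,k) = (q+1-k) C(q+1,k) = (k+1) C(q+1,k+1)]. The two factors add up to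
   [q + 2], which cancels the denominator [n - p + 1]. *)
have := mul_bin_down q.+1 k; have := mul_bin_diag q.+1 k => /=.
move=> /(congr1 (fun x => x%:R : R)) + /(congr1 (fun x => x%:R : R)).
rewrite !natrM natrB; last lia.
have : 'C(q, k)%:R != 0 :> R by rewrite pnatr_eq0 -lt0n bin_gt0.
have : 'C(q.+1, k)%:R != 0 :> R by rewrite pnatr_eq0 -lt0n bin_gt0; lia.
have : 'C(q.+1, k.+1)%:R != 0 :> R by rewrite pnatr_eq0 -lt0n bin_gt0; lia.
have : q.+1%:R != 0 :> R by rewrite pnatr_eq0.
have : q.+2%:R != 0 :> R by rewrite pnatr_eq0.
rewrite -!(natr1 q.+1) -(natr1 k).
set a : R := 'C(q.+1, k.+1)%:R; set b : R := 'C(q.+1, k)%:R.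
set c : R := 'C(q, k)%:R; set Q : R := q.+1%:R.
set d : R := n.+1%:R; move: a b c d Q => a b c d Q Q1 Q0 a0 b0 c0 ea eb.
apply: (mulfI (mulf_neq0 Q0 c0)).
have -> : Q * c * (d / (Q * c)) = d by field; rewrite c0 Q0.
rewrite mulrDr {1}eb {1}ea.
by field; rewrite a0 b0 Q1.
Qed.

(** * Marginal contributions as swings of the vote *)

(* Replacing a weight [u] by [a] on top of a total [s] flips the vote, upwards
   if [b] and downwards otherwise. *)
Definition swing (R : realType) (b : bool) (a u s : R) : bool :=
  if b then - a <= s < - u else - u <= s < - a.

(** The order of [a] and [u] rules out a flip in the opposite direction, so the difference is zero
    or the sign [2b - 1]. *)
Lemma swing_diff (R : realType) (b : bool) (a u s : R) :
  (if b then u <= a else a <= u) ->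
  (0 <= a + s)%R%:R - (0 <= u + s)%R%:R =
  (2 * b%:R - 1) * (swing b a u s)%:R :> R.
Proof.
rewrite /swing => au; rewrite -[a + s]opprK -[u + s]opprK !oppr_ge0 !opprD.
rewrite !subr_le0; case: b au => au; rewrite !ltNge;
  case: (leP (- a) s); case: (leP (- u) s) => /=; rewrite ?mulr1n ?mulr0n; lra.
Qed.

Lemma RtermE (R : realType) (N K : nat) (y : 'I_N -> bool) (yval : bool)
    (w : 'I_N -> R) (i m : 'I_N) :
  (2 <= K)%N ->
  let wt := signed_weight y yval w in
  Rterm K y yval w i m =
  \sum_(T : {set 'I_N} | [&& i \notin T, #|T| == K.-1 & below T m == T])
     (swing (y i == yval) (wt i) (wt m) (\sum_(j in T) wt j))%:R.
Proof.
move=> K_ge2 wt; rewrite /Rterm /swing -/wt.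
by case: ifP => _; rewrite sum_Fcount //; lia.
Qed.

Lemma GtildeE (R : realType) (N K : nat) (y : 'I_N -> bool) (yval : bool)
    (w : 'I_N -> R) (M : nat) (i : 'I_N) (l : nat) :
  0 <= w i -> (l < K)%N ->
  let wt := signed_weight y yval w in
  Gtilde K y yval w M i l =
  \sum_(S : {set 'I_N} | [&& i \notin S, #|S| == l & below S M == S])
     (swing (y i == yval) (wt i) 0 (\sum_(j in S) wt j))%:R.
Proof.
move=> wi_ge0 lt_lK wt; rewrite /Gtilde /swing -/wt oppr0.
(* The separate convention for [l = 0] agrees with the general formula: only the empty set, of
   weight 0, occurs, and with equal labels both sides vanish because [0 <= w i]. *)
case: (posnP l) => [->|l_gt0]; last first.
  by case: ifP => _; rewrite sum_Fcount.
rewrite (big_pred1 finset.set0) /=; last first.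
  move=> S; rewrite cards_eq0 /=; have [->|_] := eqVneq S finset.set0.
    by rewrite inE; apply/eqP/setP => j; rewrite !inE.
  by rewrite andbF.
rewrite big_set0; case: ifP => yi.
  by rewrite ltxx andbF /wt /signed_weight yi ltNge wi_ge0.
by rewrite lexx /= oppr_gt0.
Qed.

(** All points vote before and after the insertion, so adding [i] amounts to replacing a weight 0 by
    [wt i]. *)
Lemma utility_diff_small (R : realType) (N K : nat) (wt : 'I_N -> R)
    (b : bool) (i : 'I_N) (S : {set 'I_N}) :
  (if b then 0 <= wt i else wt i <= 0) ->
  i \notin S -> (#|S| < K)%N ->
  utility K wt (i |: S) - utility K wt S =
  (2 * b%:R - 1) * (swing b (wt i) 0 (\sum_(j in S) wt j))%:R.
Proof.
move=> sgn_i iS lt_SK; rewrite -swing_diff // add0r /utility.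
have /minn_idPr -> : (#|i |: S| <= K)%N by rewrite cardsU1 iS.
by rewrite (minn_idPr (ltnW lt_SK)) !prefix_weight_card big_setU1.
Qed.

Lemma belowS (N : nat) (S : {set 'I_N}) (m : 'I_N) :
  m \in S -> below S m.+1 = m |: below S m.
Proof.
move=> Sm; apply/setP => j; rewrite !inE ltnS leq_eqVlt val_eqE.
by case: eqVneq => [->|_] //=; rewrite Sm.
Qed.

Lemma utility_below (R : realType) (N K : nat) (wt : 'I_N -> R)
    (S : {set 'I_N}) (m : nat) :
  #|below S m| = K -> utility K wt S = (0 <= \sum_(j in below S m) wt j)%R%:R.
Proof.
move=> Sm; rewrite /utility (minn_idPl _) ?(prefix_weight_below _ Sm) //.
by rewrite -Sm; apply/subset_leq_card/fintype.subsetP => j; rewrite inE => /andP[].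
Qed.

(** The only candidate in the sum is the [K]-th point [m] of [S]. If [i < m], then [i] pushes [m]
    out of the vote; otherwise the first [K] points are unchanged and the sum is empty. *)
Lemma utility_diff_large (R : realType) (N K : nat) (wt : 'I_N -> R)
    (b : bool) (i : 'I_N) (S : {set 'I_N}) :
  (forall m : 'I_N, (i < m)%N -> if b then wt m <= wt i else wt i <= wt m) ->
  i \notin S -> (0 < K)%N -> (K <= #|S|)%N ->
  utility K wt (i |: S) - utility K wt S =
  (2 * b%:R - 1) *
  \sum_(m < N | [&& (i < m)%N, m \in S & #|below S m| == K.-1])
     (swing b (wt i) (wt m) (\sum_(j in below S m) wt j))%:R.
Proof.
move=> wt_i iS K_gt0 le_KS.
have [m] : exists m, alpha S K.-1.+1 = Some m.
  by apply: alpha_in_range; lia.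
move=> /[dup] alpha_m /alpha_Some[Sm card_m].
have uniq_m k : k \in S -> #|below S k| = K.-1 -> k = m.
  move=> Sk card_k; have := (alpha_Some _ _ _).2 (conj Sk card_k).
  by rewrite alpha_m => -[].
have m_notin : m \notin below S m by rewrite inE ltnn andbF.
have cardm1 : #|below S m.+1| = K by rewrite belowS // cardsU1 m_notin card_m; lia.
rewrite (utility_below wt cardm1) belowS // big_setU1 //=.
have ne_im : i != m by apply: contraNneq iS => ->.
have [lt_im|le_mi] := ltnP i m.
  have below_i : below (i |: S) m = i |: below S m.
    by apply/setP => j; rewrite !inE; case: eqVneq => [->|].
  have i_notin : i \notin below S m by rewrite inE (negbTE iS).
  rewrite (@utility_below _ _ _ _ _ m); last first.
    by rewrite below_i cardsU1 i_notin card_m; lia.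
  rewrite below_i big_setU1 //= [X in _ * X](big_pred1 m) => [|k /=].
    by apply: swing_diff; apply: wt_i.
  apply/and3P/eqP => [[_ Sk /eqP card_k]|->]; first exact: uniq_m.
  by rewrite card_m eqxx.
rewrite [X in _ * X]big1 ?mulr0 => [|k /and3P[lt_ik Sk /eqP card_k]]; last first.
  by move: lt_ik; rewrite (uniq_m k) // ltnNge le_mi.
have lt_mi : (m < i)%N by rewrite ltn_neqAle le_mi andbT eq_sym.
have below_i : below (i |: S) m.+1 = below S m.+1.
  apply/setP => j; rewrite !inE ltnS; case: eqVneq => [->|//].
  by rewrite leqNgt lt_mi /= andbF.
rewrite (@utility_below _ _ _ _ _ m.+1) below_i //.
by rewrite belowS // big_setU1 //= subrr.
Qed.

Lemma sum_utility_diff_large (R : realType) (N K : nat) (y : 'I_N -> bool)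
    (yval : bool) (w : 'I_N -> R) (i : 'I_N) (l : nat) :
  let wt := signed_weight y yval w in
  (forall j, 0 <= w j) ->
  (forall i j : 'I_N, (i <= j)%N -> w j <= w i) ->
  (2 <= K)%N -> (K <= l)%N ->
  \sum_(S : {set 'I_N} | (i \notin S) && (#|S| == l))
     (utility K wt (i |: S) - utility K wt S) =
  (2 * (y i == yval)%:R - 1) *
  \sum_(m < N | (i < m)%N) 'C(N.-1 - m, l - K)%:R * Rterm K y yval w i m.
Proof.
move=> wt w_ge0 w_mono K_ge2 le_Kl.
(* The monotonicity of the weights enters here: [wt m] has absolute value at most [w i], so all
   swings go in the direction of the label of [i]. *)
have wt_i (m : 'I_N) : (i < m)%N ->
    if y i == yval then wt m <= wt i else wt i <= wt m.
  move=> /ltnW/w_mono wmi; have wm := w_ge0 m; have wi := w_ge0 i.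
  by rewrite /wt /signed_weight; case: (y i == yval); case: (y m == yval); lra.
under eq_bigr => S /andP[iS /eqP cardS].
  rewrite (utility_diff_large wt_i) //; [over|lia|lia].
rewrite -mulr_sumr; congr (_ * _).
rewrite (exchange_big_dep (fun m : 'I_N => (i < m)%N)) /=; last first.
  by move=> S m _ /andP[].
apply: eq_bigr => m lt_im; rewrite RtermE //.
rewrite (partition_big (fun S => below S m)
  (fun T => [&& i \notin T, #|T| == K.-1 & below T m == T])) /=; last first.
  move=> S /and3P[/andP[iS _] _ /andP[_ ->]]; rewrite inE (negbTE iS) /=.
  by apply/eqP/setP => j; rewrite !inE -andbA andbb.
rewrite mulr_sumr; apply: eq_bigr => T /and3P[iT /eqP cardT /eqP Tm].
(* Since [i < m], membership of [i] in [S] is decided by [T], so [i \notin S] follows from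
   [i \notin T] and every extension counts. *)
rewrite (eq_bigl (fun S => S \in
  [set S : {set 'I_N} | [&& #|S| == l, m \in S & below S m == T]])); last first.
  move=> S; rewrite inE lt_im /=; case: (m \in S); rewrite ?andbF //=.
  case: (eqVneq (below S m) T) => [eT|_]; rewrite ?andbF //.
  rewrite eT cardT eqxx !andbT; case: (#|S| == l); rewrite ?andbF // andbT.
  by move: iT; rewrite -eT inE lt_im andbT.
rewrite (eq_bigr (fun=> (swing (y i == yval) (wt i) (wt m)
                           (\sum_(j in T) wt j))%:R)); last first.
  by move=> S; rewrite inE => /and3P[_ _ /eqP->].
rewrite sumr_const card_extensions ?cardT //; last lia.
by rewrite -[LHS]mulr_natl prednK //; lia.
Qed.

(** * The exact value as a series of terms of constant sign *)

(** This is [phihat] without its sign factor; [M = N] will give the exact value. *)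
Definition shapley_magnitude (R : realType) (N K : nat) (y : 'I_N -> bool)
    (yval : bool) (w : 'I_N -> R) (M : nat) (i : 'I_N) : R :=
  N%:R^-1 * (\sum_(0 <= l < K) Gtilde K y yval w M i l / 'C(N.-1, l)%:R)
  + \sum_(m < N | (maxn i.+2 K.+1 <= m.+1 <= M)%N)
      Rterm K y yval w i m / (m.+1%:R * 'C(m, K)%:R).

(** A set [T] counted here, together with [i], would put [K] points below [m]. This accounts for the
    bound [K.+1] in the range of [phihat]. *)
Lemma Rterm_small (R : realType) (N K : nat) (y : 'I_N -> bool) (yval : bool)
    (w : 'I_N -> R) (i m : 'I_N) :
  (2 <= K)%N -> (i < m)%N -> (m < K)%N -> Rterm K y yval w i m = 0.
Proof.
move=> K_ge2 lt_im lt_mK; rewrite RtermE // big_pred0 // => T.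
apply/negP => /and3P[iT /eqP cardT /eqP Tm].
suff : (#|i |: T| <= m)%N by rewrite cardsU1 iT cardT; lia.
rewrite -[leqRHS](@card_ord_lt N) ?(ltnW (ltn_ord m)) //.
apply/subset_leq_card/fintype.subsetP => j.
by rewrite -Tm !inE => /predU1P[->|/andP[]].
Qed.

(** After shifting [l] by [K], the binomials vanish beyond [N - 1 - m], and [sum_binomial_ratio]
    applies with [n = N - 1], [p = N - 1 - m]. *)
Lemma sum_extension_weights (R : realType) (N K m : nat) :
  (K <= m)%N -> (m < N)%N ->
  N%:R^-1 * \sum_(K <= l < N) ('C(N.-1 - m, l - K)%:R / 'C(N.-1, l)%:R : R) =
  (m.+1%:R * 'C(m, K)%:R)^-1.
Proof.
move=> le_Km lt_mN; rewrite -{1}(add0n K) big_addn.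
under eq_bigr do rewrite addnK.
rewrite (big_cat_nat _ (n := (N.-1 - m).+1)) //=; last lia.
rewrite [X in _ + X]big_nat_cond [X in _ + X]big1 ?addr0; last first.
  by move=> j; rewrite andbT => /andP[lt_j _]; rewrite bin_small ?mul0r.
rewrite sum_binomial_ratio; last lia.
have -> : (N.-1 - (N.-1 - m) = m)%N by lia.
by rewrite prednK ?mulKf ?pnatr_eq0 //; lia.
Qed.

(** Set sizes are split at [K]. Small sizes give the [Gtilde] part; for large sizes, summing first
    over [l] collapses the coefficient of each [Rterm] to a single fraction. *)
Lemma shapleyE (R : realType) (N K : nat) (y : 'I_N -> bool)
    (yval : bool) (w : 'I_N -> R) (i : 'I_N) :
  (forall j, 0 <= w j) ->
  (forall i j : 'I_N, (i <= j)%N -> w j <= w i) ->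
  (2 <= K)%N -> (K <= N)%N ->
  shapley (utility K (signed_weight y yval w)) i =
  (2 * (y i == yval)%:R - 1) * shapley_magnitude K y yval w N i.
Proof.
move=> w_ge0 w_mono K_ge2 le_KN; rewrite /shapley big_add1 /=.
rewrite (big_cat_nat _ (n := K)) //= mulrDr /shapley_magnitude mulrDr.
congr (_ + _).
  rewrite mulrCA; congr (_ * _); rewrite mulr_sumr.
  apply: eq_big_nat => l /andP[_ lt_lK]; rewrite GtildeE // mulrC mulrA.
  congr (_ / _); rewrite mulr_sumr; apply: eq_big => [S|S /andP[iS /eqP cardS]].
    by rewrite below_ord eqxx andbT.
  apply: utility_diff_small; rewrite ?cardS //.
  by rewrite /signed_weight; case: (y i == yval); rewrite ?oppr_le0.
transitivity ((2 * (y i == yval)%:R - 1) * \sum_(m < N | (i < m)%N)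
    Rterm K y yval w i m * (N%:R^-1 * \sum_(K <= l < N)
      ('C(N.-1 - m, l - K)%:R / 'C(N.-1, l)%:R : R))).
  rewrite mulr_sumr.
  under eq_big_nat => l /andP[le_Kl _].
    rewrite sum_utility_diff_large // !mulr_sumr; over.
  rewrite exchange_big /= mulr_sumr; apply: eq_bigr => m lt_im.
  rewrite !mulr_sumr; apply: eq_bigr => l _; ring.
congr (_ * _); rewrite (bigID (fun m : 'I_N => (K <= m)%N)) /= addrC big1 ?add0r.
  apply: eq_big => [m|m /andP[_ le_Km]]; first by have := ltn_ord m; lia.
  by rewrite sum_extension_weights.
by move=> m /andP[lt_im]; rewrite -ltnNge => lt_mK; rewrite Rterm_small ?mul0r.
Qed.

(** * Bounds on the terms and on the truncation error *)

Lemma below_sub (N : nat) (S : {set 'I_N}) (m : nat) :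
  (below S m == S) = (S \subset [set j : 'I_N | (j < m)%N]).
Proof.
rewrite below_id; apply/forall_inP/fintype.subsetP => lt_m j Sj.
  by rewrite inE lt_m.
by have := lt_m j Sj; rewrite inE.
Qed.

Lemma Rterm_ge0 (R : realType) (N K : nat) (y : 'I_N -> bool) (yval : bool)
    (w : 'I_N -> R) (i m : 'I_N) :
  (2 <= K)%N -> 0 <= Rterm K y yval w i m.
Proof. by move=> K_ge2; rewrite RtermE // sumr_ge0 // => T _; apply: ler0n. Qed.

Lemma Rterm_le (R : realType) (N K : nat) (y : 'I_N -> bool) (yval : bool)
    (w : 'I_N -> R) (i m : 'I_N) :
  (2 <= K)%N -> Rterm K y yval w i m <= 'C(m, K.-1)%:R.
Proof.
move=> K_ge2; rewrite RtermE //.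
apply: (@le_trans _ _ (\sum_(T : {set 'I_N} |
    [&& i \notin T, #|T| == K.-1 & below T m == T]) 1%N%:R)).
  by apply: ler_sum => T _; case: swing.
rewrite -natr_sum ler_nat sum1_card -[in leqRHS](@card_ord_lt N m) ?(ltnW (ltn_ord m)) //.
rewrite -cards_draws; apply/subset_leq_card/fintype.subsetP => T.
by rewrite unfold_in inE below_sub => /and3P[_ -> ->].
Qed.

Lemma Gtilde_ge0 (R : realType) (N K : nat) (y : 'I_N -> bool) (yval : bool)
    (w : 'I_N -> R) (M : nat) (i : 'I_N) (l : nat) :
  0 <= w i -> (l < K)%N -> 0 <= Gtilde K y yval w M i l.
Proof.
by move=> w_ge0 lt_lK; rewrite GtildeE // sumr_ge0 // => S _; apply: ler0n.
Qed.

(** The difference counts swinging sets not contained in the [M] nearest points. Forgetting the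
    swing and the condition on [i] leaves all [l]-sets that are not so contained. *)
Lemma Gtilde_truncation (R : realType) (N K : nat) (y : 'I_N -> bool)
    (yval : bool) (w : 'I_N -> R) (M : nat) (i : 'I_N) (l : nat) :
  0 <= w i -> (l < K)%N -> (M <= N)%N ->
  0 <= Gtilde K y yval w N i l - Gtilde K y yval w M i l
    <= 'C(N, l)%:R - 'C(M, l)%:R.
Proof.
move=> w_ge0 lt_lK le_MN; rewrite !GtildeE //.
rewrite (bigID (fun S : {set 'I_N} => below S M == S)) /=.
rewrite (eq_bigl (fun S : {set 'I_N} => [&& i \notin S, #|S| == l & below S M == S])); last first.
  by move=> S; rewrite below_ord eqxx andbT -andbA.
rewrite addrAC subrr add0r sumr_ge0 /=; last by move=> S _; apply: ler0n.
rewrite lerBrDr.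
apply: (@le_trans _ _ (\sum_(S : {set 'I_N} | (#|S| == l) && (below S M != S)) 1%N%:R
    + 'C(M, l)%:R)).
  rewrite lerD2r big_mkcond [leRHS]big_mkcond /=; apply: ler_sum => S _.
  case: (i \notin S) => /=; last by case: ifP.
  by rewrite below_ord eqxx andbT; case: ifP => // _; case: swing.
rewrite -natr_sum -natrD ler_nat -[X in 'C(X, l)](card_ord_lt le_MN).
rewrite -cards_draws -[X in (_ <= 'C(X, l))%N](card_ord N) -card_draws -!sum1_card.
rewrite [leqRHS](bigID (fun S : {set 'I_N} => below S M == S)) /= addnC.
apply/eq_leq; congr (_ + _)%N; apply: eq_bigl => S; rewrite !inE ?below_sub //.
by rewrite andbC.
Qed.

Lemma shapley_magnitude_ge0 (R : realType) (N K : nat) (y : 'I_N -> bool)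
    (yval : bool) (w : 'I_N -> R) (M : nat) (i : 'I_N) :
  0 <= w i -> (2 <= K)%N -> 0 <= shapley_magnitude K y yval w M i.
Proof.
move=> w_ge0 K_ge2; apply: addr_ge0.
  apply: mulr_ge0; first by rewrite invr_ge0.
  rewrite big_nat_cond sumr_ge0 // => l /andP[/andP[_ lt_lK] _].
  by rewrite divr_ge0 ?Gtilde_ge0.
by rewrite sumr_ge0 // => m _; rewrite divr_ge0 ?Rterm_ge0 ?mulr_ge0.
Qed.

(** With [Rterm] bounded by [C(m,K-1)] and [(m+1-K) C(m,K-1) = K C(m,K)], the ratio is at most
    [K / ((m+1)(m+1-K))], which is the right side. *)
Lemma Rterm_ratio_le (R : realType) (N K : nat) (y : 'I_N -> bool)
    (yval : bool) (w : 'I_N -> R) (i m : 'I_N) :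
  (2 <= K)%N -> (K <= m)%N ->
  Rterm K y yval w i m / (m.+1%:R * 'C(m, K)%:R) <=
  (m.+1%:R - K%:R)^-1 - m.+1%:R^-1.
Proof.
move=> K_ge2 le_Km.
have c_gt0 : 0 < 'C(m, K)%:R :> R by rewrite ltr0n bin_gt0.
have := mul_bin_left m K.-1; rewrite prednK; last lia.
have -> : (m - K.-1 = m.+1 - K)%N by lia.
move/(congr1 (fun x => x%:R : R)); rewrite !natrM natrB; last lia.
have e_gt0 : 0 < m.+1%:R - K%:R :> R by rewrite subr_gt0 ltr_nat.
have m_gt0 : 0 < m.+1%:R :> R by rewrite ltr0n.
have := @Rterm_le R N K y yval w i m K_ge2.
move: c_gt0 e_gt0 m_gt0; set c : R := 'C(m, K)%:R; set d : R := 'C(m, K.-1)%:R.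
set k : R := K%:R; set n : R := m.+1%:R.
move: c d k n (Rterm _ _ _ _ _ _) => c d k n r c_gt0 e_gt0 n_gt0 le_rd eq_kc.
have -> : (n - k)^-1 - n^-1 = d / (n * c).
  have -> : d = k * c / (n - k) by rewrite eq_kc mulrAC divff ?mul1r ?gt_eqF.
  by field; rewrite !gt_eqF.
by rewrite ler_pM2r // invr_gt0 mulr_gt0.
Qed.

Lemma shapley_magnitude_truncation (R : realType) (N K : nat)
    (y : 'I_N -> bool) (yval : bool) (w : 'I_N -> R) (M : nat) (i : 'I_N) :
  0 <= w i -> (2 <= K)%N -> (K <= M)%N -> (M <= N)%N ->
  0 <= shapley_magnitude K y yval w N i - shapley_magnitude K y yval w M i
    <= epsilon R N K M.
Proof.
move=> w_ge0 K_ge2 le_KM le_MN; rewrite /shapley_magnitude opprD addrACA.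
rewrite -mulrBr -sumrB; under eq_bigr do rewrite -mulrBl.
set T : nat -> bool := (fun m => maxn i.+2 K.+1 <= m.+1)%N.
have -> : \sum_(m < N | (maxn i.+2 K.+1 <= m.+1 <= N)%N)
       Rterm K y yval w i m / (m.+1%:R * 'C(m, K)%:R) =
    \sum_(m < N | (maxn i.+2 K.+1 <= m.+1 <= M)%N)
       Rterm K y yval w i m / (m.+1%:R * 'C(m, K)%:R) +
    \sum_(m < N | T m && (M <= m)%N)
       Rterm K y yval w i m / (m.+1%:R * 'C(m, K)%:R).
  rewrite (bigID (fun m : 'I_N => (m < M)%N)) /=; congr (_ + _);
    apply: eq_bigl => m; have := ltn_ord m; rewrite /T; lia.
rewrite [X in _ + X]addrAC subrr add0r; apply/andP; split.
  apply: addr_ge0.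
    apply: mulr_ge0; first by rewrite invr_ge0.
    rewrite big_nat_cond sumr_ge0 // => l /andP[/andP[_ lt_lK] _].
    rewrite divr_ge0 //.
    by have /andP[] := Gtilde_truncation y yval w_ge0 lt_lK le_MN.
  by rewrite sumr_ge0 // => m _; rewrite divr_ge0 ?Rterm_ge0 ?mulr_ge0.
rewrite /epsilon addrC lerD //.
  rewrite big_add1 /= (big_nat_widenl _ 0) // big_mkord.
  rewrite [leLHS]big_mkcond [leRHS]big_mkcond /=; apply: ler_sum => m _.
  rewrite andbC; case: leqP => //= le_Mm; have le_Km := leq_trans le_KM le_Mm.
  case: ifP => _; first exact: Rterm_ratio_le.
  rewrite subr_ge0 lef_pV2 ?posrE ?ltr0n ?subr_gt0 ?ltr_nat //.
  by rewrite gerBl.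
rewrite big_ltn; last lia.
have le_l l : (l < K)%N ->
    Gtilde K y yval w N i l - Gtilde K y yval w M i l <=
    'C(N, l)%:R - 'C(M, l)%:R.
  by move=> lt_lK; have /andP[] := Gtilde_truncation y yval w_ge0 lt_lK le_MN.
(* The sum in [epsilon] starts at [l = 1]; the term [l = 0] costs nothing because
   [C(N,0) - C(M,0) = 0]. *)
rewrite mulrDr -[leRHS]add0r lerD //.
  have := le_l 0%N; rewrite !bin0 subrr => /(_ _)-/(_ (ltnW K_ge2)) le0.
  by rewrite invr1 mulr1 mulr_ge0_le0 ?invr_ge0.
rewrite mulr_sumr big_nat_cond [leRHS]big_nat_cond.
apply: ler_sum => l /andP[/andP[_ lt_lK] _].
rewrite mulrCA invfM ler_wpM2r //; first by rewrite mulr_ge0 ?invr_ge0.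
exact: le_l.
Qed.

(** * Size of the error bound *)

Lemma epsilon_ge0 (R : realType) (N K M : nat) :
  (K <= M)%N -> (M <= N)%N -> 0 <= epsilon R N K M.
Proof.
move=> le_KM le_MN; apply: addr_ge0.
  rewrite big_nat_cond sumr_ge0 // => m /andP[/andP[lt_Mm _] _].
  rewrite subr_ge0 lef_pV2 ?posrE ?ltr0n ?subr_gt0 ?ltr_nat ?gerBl //; lia.
rewrite sumr_ge0 // => l _; apply: divr_ge0; last by rewrite mulr_ge0.
by rewrite subr_ge0 ler_nat leq_bin2l.
Qed.

(** Each of the two sums is at most [2K/M]. The hypothesis [2K <= M] yields [m - K >= (m-1)/2] in
    the first and [N - l >= M/2] in the second. *)
Lemma epsilon_le (R : realType) (N K M : nat) :
  (0 < K)%N -> (2 * K <= M)%N -> (M <= N)%N ->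
  epsilon R N K M <= 4 * (K%:R / M%:R).
Proof.
move=> K_gt0 le_KM le_MN.
have M_gt0 : 0 < M%:R :> R by rewrite ltr0n; lia.
have K_gt0R : 0 < K%:R :> R by rewrite ltr0n.
have le_KMR : 2 * K%:R <= M%:R :> R by rewrite -natrM ler_nat.
have -> : 4 * (K%:R / M%:R) = 2 * K%:R / M%:R + 2 * K%:R / M%:R :> R by ring.
apply: lerD.
  (* K / (m (m - K)) <= 2 K / (m (m - 1)), which telescopes *)
  apply: (@le_trans _ _ (\sum_(M <= m < N)
      (2 * K%:R * - m.+1%:R^-1 - 2 * K%:R * - m%:R^-1))).
    rewrite big_add1 /= big_nat_cond [leRHS]big_nat_cond.
    apply: ler_sum => m /andP[/andP[le_Mm _] _]; rewrite -natr1.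
    have : M%:R <= m%:R :> R by rewrite ler_nat.
    move: M%:R K%:R m%:R M_gt0 K_gt0R le_KMR => a k x a0 k0 ka ax.
    have x0 : 0 < x by lra.
    have e0 : 0 < x + 1 - k by lra.
    have -> : (x + 1 - k)^-1 - (x + 1)^-1 = k * ((x + 1)^-1 * (x + 1 - k)^-1).
      by field; rewrite !gt_eqF //; lra.
    have -> : 2 * k * - (x + 1)^-1 - 2 * k * - x^-1 = k * ((x + 1)^-1 * (x / 2)^-1).
      by field; rewrite !gt_eqF //; lra.
    rewrite ler_pM2l // ler_pM2l ?invr_gt0; last lra.
    by rewrite lef_pV2 ?posrE; lra.
  rewrite telescope_sumr //.
  have : 0 <= N%:R^-1 :> R by rewrite invr_ge0.
  by move=> N0; rewrite !mulrN opprK gerDr oppr_le0 mulr_ge0 //; lra.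
apply: (@le_trans _ _ (\sum_(1 <= l < K) 2 / M%:R)).
  rewrite big_nat_cond [leRHS]big_nat_cond.
  apply: ler_sum => l /andP[/andP[_ lt_lK] _].
  (* As [N C(N-1,l) = (N-l) C(N,l)], each term is at most [1/(N-l)], hence at most [2/M]. *)
  rewrite -natrM; have -> : (N * 'C(N.-1, l) = (N - l) * 'C(N, l))%N.
    exact: mul_bin_down.
  have c_gt0 : 0 < 'C(N, l)%:R :> R by rewrite ltr0n bin_gt0; lia.
  have e_gt0 : 0 < (N - l)%:R :> R by rewrite ltr0n subn_gt0; lia.
  have le_e : M%:R <= 2 * (N - l)%:R :> R by rewrite -natrM ler_nat; lia.
  rewrite natrM ler_pdivrMr ?mulr_gt0 //.
  apply: (@le_trans _ _ 'C(N, l)%:R); first by rewrite gerBl.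
  by rewrite mulrA ler_peMl // mulrAC ler_pdivlMr // mul1r.
rewrite sumr_const_nat -[leLHS]mulr_natr mulrAC ler_pM2r ?invr_gt0 //.
by rewrite ler_pM2l // ler_nat leq_subr.
Qed.

(** * Comparison of the approximation with the exact value *)

Theorem theorem8 (R : realType) :
  (forall (X : Type) (d : X -> X -> R) (N K M : nat)
     (x : 'I_N -> X) (y : 'I_N -> bool) (xval : X) (yval : bool)
     (w : 'I_N -> R),
     (2 <= K)%N -> (K <= N)%N -> (K <= M)%N -> (M <= N)%N ->
     (forall i j : 'I_N, (i <= j)%N -> d (x i) xval <= d (x j) xval) ->
     (forall j : 'I_N, 0 <= w j <= 1) ->
     (* weights do not increase with the rank of the point; the claim fails
        without this *)
     (forall i j : 'I_N, (i <= j)%N -> w j <= w i) ->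
     forall i : 'I_N,
       let phi := shapley (utility K (signed_weight y yval w)) i in
       let phi_hat := phihat K y yval w M i in
       [/\ phi_hat != 0 -> Num.sg phi_hat = Num.sg phi,
           `|phi_hat| <= `|phi|
         & `|phi_hat - phi| <= epsilon R N K M])
  /\
  (exists C : R, forall K : nat, (2 <= K)%N ->
     exists M0 : nat, forall M N : nat,
       (M0 <= M)%N -> (K <= M)%N -> (M <= N)%N ->
       `|epsilon R N K M| <= C * (K%:R / M%:R)).
Proof.
split=> [X d N K M x y xval yval w K_ge2 le_KN le_KM le_MN _ w01 w_mono i|].
  have w_ge0 j : 0 <= w j by have /andP[] := w01 j.
  rewrite /= shapleyE //.
  rewrite (_ : phihat _ _ _ _ _ _ =
    (2 * (y i == yval)%:R - 1) * shapley_magnitude K y yval w M i) //.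
  have := @shapley_magnitude_ge0 R N K y yval w M i (w_ge0 i) K_ge2.
  have /andP[] := @shapley_magnitude_truncation R N K y yval w M i (w_ge0 i) K_ge2 le_KM le_MN.
  set B := shapley_magnitude _ _ _ _ N _; set A := shapley_magnitude _ _ _ _ M _.
  set e := epsilon R N K M; move=> + le_e A_ge0; rewrite subr_ge0 => le_AB.
  set s : R := 2 * _ - 1; have norm_s : `|s| = 1.
    rewrite /s; case: (y i == yval); last by rewrite mulr0 sub0r normrN1.
    by rewrite mulr1 mulr2n addrK normr1.
  split.
  (* A nonzero truncated magnitude is positive, which forces the exact one to be positive. The
     truncation may also drop every nonzero term, hence the restriction to [phi_hat != 0]. *)
  - rewrite mulf_eq0 negb_or !sgrM => /andP[_ A_neq0]; congr (_ * _).
    have A_gt0 : 0 < A by rewrite lt0r A_neq0.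
    by rewrite !gtr0_sg // (lt_le_trans A_gt0).
  - by rewrite !normrM norm_s !mul1r !ger0_norm // (le_trans A_ge0).
  - by rewrite -mulrBr normrM norm_s mul1r distrC ger0_norm // subr_ge0.
exists 4 => K K_ge2; exists (2 * K)%N => M N le_M le_KM le_MN.
by rewrite ger0_norm ?epsilon_ge0 // epsilon_le //; lia.
Qed.
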